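(* There is an algorithm which, given a simple LQCA $A=(\Sigma,q,N,\delta)$ with $|N|=r$, decides whether all columns $U_A(\cdot,c)$, $c\in\mathcal C_A$, of its time evolution operator have norm $1$, in time $O(n^2)$ in the algebraic model of computation, where $n=|\Sigma|^{r+1}$.
   Context: A linear quantum cellular automaton (LQCA) is a tuple $A=(\Sigma,q,N,\delta)$ where $\Sigma$ is a finite nonempty set of states, $N=(a_1,\dots,a_r)$ is a strictly increasing sequence of integers, $\delta:\Sigma^r\to\mathbb C^\Sigma$ satisfies $\|\delta(w)\|>0$ for all $w$, and $q\in\Sigma$ satisfies $[\delta(q,\dots,q)](x)=1$ if $x=q$ and $0$ otherwise. It is simple if $a_r-a_1=r-1$. The input is the table of $\delta$. In the algebraic model, complex numbers occupy unit space and arithmetic operations and comparisons take unit time. A configuration is a map $c:\mathbb Z\to\Sigma$ with $c_i\ne q$ for only finitely many $i$; $\mathcal C_A$ is the set of configurations. With $c_{i+N}=(c_{i+a_1},\dots,c_{i+a_r})$, $U_A(d,c)=\prod_{i\in\mathbb Z}[\delta(c_{i+N})](d_i)$, and $U_A(\cdot,c)$ is the column $d\mapsto U_A(d,c)$ in $\ell_2(\mathcal C_A)$. *)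

(* Defs.v *)
(* mathcomp + mathcomp-analysis (esum, fsbigop) + real_closed (complex numbers R[i]). *)
From HB Require Import structures.
From mathcomp Require Import all_boot all_order all_algebra.
From mathcomp Require Import all_classical all_reals.
From mathcomp Require Import topology normedtype sequences esum.
From mathcomp.real_closed Require Import complex.

Set Implicit Arguments.
Unset Strict Implicit.
Unset Printing Implicit Defensive.
Import Order.TTheory GRing.Theory Num.Theory.
Local Open Scope ring_scope.
Local Open Scope classical_set_scope.

(* Linear quantum cellular automata.  The complex numbers are R[i] for an     *)
(* arbitrary realType R.  Sigma is a finite type, q : Sigma the quiescent      *)
(* state, N = (a_1,...,a_r) an r-tuple of integers, delta the local rule.     *)
Section LQCA.
Variables (R : realType) (Sigma : finType) (r : nat).
Local Notation C := R[i].

(* A = (Sigma, q, N, delta) is an LQCA. *)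
Definition is_LQCA (q : Sigma) (N : r.-tuple int)
    (delta : r.-tuple Sigma -> Sigma -> C) : Prop :=
  [/\ (0 < r)%N,
      sorted (fun a b : int => a < b) N,
      (* ||delta(w)|| > 0, written as ||delta(w)||^2 > 0 *)
      (forall w : r.-tuple Sigma, 0 < \sum_(x : Sigma) ComplexField.Normc.normc (delta w x) ^+ 2) &
      (forall x : Sigma, delta [tuple of nseq r q] x = (x == q)%:R)].

(* simple: a_r - a_1 = r - 1 *)
Definition simple_nbhd (N : r.-tuple int) : Prop :=
  nth 0 N r.-1 - nth 0 N 0 = (r.-1)%:Z.

(* the set C_A of configurations *)
Definition config (q : Sigma) : set (int -> Sigma) :=
  [set c | finite_set [set i | c i != q]].

(* c_{i+N} *)
Definition nbhd_at (N : r.-tuple int) (c : int -> Sigma) (i : int)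
    : r.-tuple Sigma := map_tuple (fun a => c (i + a)) N.

(* U_A(d,c) = prod_{i in Z} [delta(c_{i+N})](d_i)  (product over the finitely
   many factors different from 1) *)
Definition U_A (N : r.-tuple int) (delta : r.-tuple Sigma -> Sigma -> C)
    (d c : int -> Sigma) : C :=
  \big[*%R/1]_(i \in [set: int]) delta (nbhd_at N c i) (d i).

(* squared l2-norm of the column U_A(.,c) in l2(C_A) *)
Definition column_sqnorm (q : Sigma) (N : r.-tuple int)
    (delta : r.-tuple Sigma -> Sigma -> C) (c : int -> Sigma) : \bar R :=
  \esum_(d in config q) (ComplexField.Normc.normc (U_A N delta d c) ^+ 2)%:E.

(* Position of delta(w)(x) in the input table. *)
Definition table_index (w : r.-tuple Sigma) (x : Sigma) : nat :=
  ((\sum_(k < r) enum_rank (tnth w k) * #|Sigma| ^ k) * #|Sigma|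
   + enum_rank x)%N.

End LQCA.

(* Algebraic RAM model: unboundedly many registers holding complex numbers   *)
(* (unit space each) and index registers holding naturals; every instruction *)
(* (arithmetic, conjugation, comparison, indirect addressing, jump) costs one *)
(* time unit.                                                                *)
Inductive instr : Type :=
| CConst of nat & nat          (* c[d] := k%:R                *)
| CAdd of nat & nat & nat      (* c[d] := c[a] + c[b]         *)
| CSub of nat & nat & nat      (* c[d] := c[a] - c[b]         *)
| CMul of nat & nat & nat      (* c[d] := c[a] * c[b]         *)
| CDiv of nat & nat & nat      (* c[d] := c[a] / c[b]         *)
| CConj of nat & nat           (* c[d] := conj c[a]           *)
| CLoad of nat & nat           (* c[d] := c[ n[a] ]           *)
| CStore of nat & nat          (* c[ n[a] ] := c[s]           *)
| NConst of nat & nat          (* n[d] := k                   *)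
| NAdd of nat & nat & nat      (* n[d] := n[a] + n[b]         *)
| NSub of nat & nat & nat      (* n[d] := n[a] - n[b] (trunc) *)
| NMul of nat & nat & nat      (* n[d] := n[a] * n[b]         *)
| NLoad of nat & nat           (* n[d] := n[ n[a] ]           *)
| NStore of nat & nat          (* n[ n[a] ] := n[s]           *)
| JEqC of nat & nat & nat      (* if c[a] == c[b] goto l      *)
| JLeC of nat & nat & nat      (* if c[a] <= c[b] goto l      *)
| JEqN of nat & nat & nat      (* if n[a] == n[b] goto l      *)
| JLtN of nat & nat & nat      (* if n[a] < n[b] goto l       *)
| Jmp of nat                   (* goto l                      *)
| Halt.

Section Machine.
Variable C : numClosedFieldType.

Record mstate := MState { pc : nat; creg : nat -> C; ireg : nat -> nat }.

Definition upd {T : Type} (f : nat -> T) (k : nat) (v : T) : nat -> T :=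
  fun j => if j == k then v else f j.

Definition step (P : seq instr) (s : mstate) : mstate :=
  let: MState p c n := s in
  let nx := p.+1 in
  match nth Halt P p with
  | CConst d k => MState nx (upd c d k%:R) n
  | CAdd d a b => MState nx (upd c d (c a + c b)) n
  | CSub d a b => MState nx (upd c d (c a - c b)) n
  | CMul d a b => MState nx (upd c d (c a * c b)) n
  | CDiv d a b => MState nx (upd c d (c a / c b)) n
  | CConj d a => MState nx (upd c d (c a)^*) n
  | CLoad d a => MState nx (upd c d (c (n a))) n
  | CStore a s => MState nx (upd c (n a) (c s)) n
  | NConst d k => MState nx c (upd n d k)
  | NAdd d a b => MState nx c (upd n d (n a + n b)%N)
  | NSub d a b => MState nx c (upd n d (n a - n b)%N)
  | NMul d a b => MState nx c (upd n d (n a * n b)%N)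
  | NLoad d a => MState nx c (upd n d (n (n a)))
  | NStore a s => MState nx c (upd n (n a) (n s))
  | JEqC a b l => MState (if c a == c b then l else nx) c n
  | JLeC a b l => MState (if c a <= c b then l else nx) c n
  | JEqN a b l => MState (if n a == n b then l else nx) c n
  | JLtN a b l => MState (if (n a < n b)%N then l else nx) c n
  | Jmp l => MState l c n
  | Halt => s
  end.

(* A state is halted when the current instruction is Halt (or the program
   counter is past the end of the program). *)
Definition halted (P : seq instr) (s : mstate) : bool :=
  if nth Halt P (pc s) is Halt then true else false.

(* The answer is "yes" iff index register 0 is nonzero at halting time. *)
Definition accepts (s : mstate) : bool := ireg s 0 != 0%N.

(* state after t steps *)
Definition run (P : seq instr) (t : nat) (s : mstate) : mstate :=
  iter t (step P) s.

End Machine.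

(* Main.v *)
(* The column of [c] has squared norm [prod_i ||delta(c_{i+N})||^2], so the     *)
(* columns are the closed walks from [q...q] to itself in the de Bruijn graph   *)
(* with vertices [Sigma^(r-1)] and edges [Sigma^r], the edge [w] weighted by    *)
(* [||delta(w)||^2].  Every vertex lies on such a walk, so all closed walks     *)
(* have weight 1 iff there is a potential [g] with [g(q...q) = 1] and           *)
(* [g(source) * weight = g(target)] along every edge.  The machine searches for *)
(* one by [r] rounds of relaxation over all edges.  After [r-1] rounds every    *)
(* vertex has been reached, so the last round changes nothing iff a potential   *)
(* exists.  A round costs [O(n)] steps and [r <= n] unless [Sigma] is a         *)
(* singleton; a one-letter automaton is accepted at once, since [r] is then     *)
(* not bounded in terms of [n = 1].                                             *)
Require Import Defs.
From HB Require Import structures.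
From mathcomp Require Import all_boot all_order all_algebra.
From mathcomp Require Import all_classical all_reals.
From mathcomp Require Import topology normedtype sequences esum.
From mathcomp.real_closed Require Import complex.
From mathcomp Require Import zify.
Import Order.TTheory GRing.Theory Num.Theory.

Set Implicit Arguments.
Unset Strict Implicit.
Unset Printing Implicit Defensive.

Local Arguments run : simpl never.

(** * A structured language over the machine *)

(** A column is a tensor product of the vectors [delta (nbhd_at N c i)], all but finitely many of
    them the basis vector of [q], so its squared norm factors ([column_sqnorm_prod]). The
    neighbourhood is an interval, so consecutive factors share [r.-1] letters and the product is the
    weight of a closed walk.

    [columns_potential] thereby replaces infinitely many conditions by a finite system of equations:
    a potential telescopes along walks ([potential_telescope]), and conversely the weights of walks
    out of the quiescent vertex form a potential ([potential_of_closed_walks]). Relaxation decides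
    the system ([relaxation_correct]), because every nonzero value it computes must be a value of
    the potential, if there is one. [lqca_program_run] transfers this to the machine; its time bound
    comes from proof rules that carry a step budget. *)

Inductive cmd : Type :=
| Block of seq instr
| Seq of cmd & cmd
| WhileLt of nat & nat & cmd
| UnlessEqC of nat & nat & cmd
| UnlessEqN of nat & nat & cmd.

(** Jump targets are absolute, so the code depends on the address [p] where it will stand. *)
Fixpoint compile (p : nat) (k : cmd) : seq instr :=
  match k with
  | Block l => l
  | Seq k1 k2 => compile p k1 ++ compile (p + size (compile p k1)) k2
  | WhileLt a b k1 =>
      [:: JLtN a b p.+2; Jmp (p.+2 + size (compile p.+2 k1)).+1]
        ++ rcons (compile p.+2 k1) (Jmp p)
  | UnlessEqC a b k1 =>
      JEqC a b (p.+1 + size (compile p.+1 k1)) :: compile p.+1 k1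
  | UnlessEqN a b k1 =>
      JEqN a b (p.+1 + size (compile p.+1 k1)) :: compile p.+1 k1
  end.

Definition straight (i : instr) : bool :=
  match i with
  | JEqC _ _ _ | JLeC _ _ _ | JEqN _ _ _ | JLtN _ _ _ | Jmp _ | Halt => false
  | _ => true
  end.

Definition code_at (P : seq instr) (p : nat) (l : seq instr) : Prop :=
  forall k, (k < size l)%N -> nth Halt P (p + k) = nth Halt l k.

Lemma code_at_cons P p i l :
  code_at P p (i :: l) <-> nth Halt P p = i /\ code_at P p.+1 l.
Proof.
split=> [h|[h0 h] [|k] kl]; last 2 first.
- by rewrite addn0.
- by rewrite addnS -addSn h.
by split=> [|k kl]; [rewrite -[p]addn0 h | rewrite addSnnS h].
Qed.

Lemma code_at_cat P p l1 l2 :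
  code_at P p (l1 ++ l2) <-> code_at P p l1 /\ code_at P (p + size l1) l2.
Proof.
elim: l1 p => [|i l1 IH] p; first by rewrite addn0; split=> [|[]].
rewrite cat_cons !code_at_cons IH /= addSnnS.
by split=> [[? []]|[[? ?] ?]].
Qed.

(** * Proof rules for total correctness with a step budget *)

Section Runs.
Variable C : numClosedFieldType.
Implicit Types (c : nat -> C) (n : nat -> nat).

Definition exec (i : instr) (x : (nat -> C) * (nat -> nat)) :=
  let s := step [:: i] (MState 0 x.1 x.2) in (creg s, ireg s).

Fixpoint execs (l : seq instr) (x : (nat -> C) * (nat -> nat)) :=
  if l is i :: l' then execs l' (exec i x) else x.

Lemma step_straight P p c n :
  straight (nth Halt P p) ->
  step P (MState p c n) =
  MState p.+1 (exec (nth Halt P p) (c, n)).1 (exec (nth Halt P p) (c, n)).2.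
Proof. by rewrite /step /exec /=; case: (nth Halt P p). Qed.

(** A Hoare-style judgement: from the registers [c], [n] the code of [k] is left at its end within
    [T] steps, with [Q] true. Quantifying over the surrounding program and the address makes it
    compositional. *)
Definition runs (k : cmd) c n (T : nat)
    (Q : (nat -> C) -> (nat -> nat) -> Prop) : Prop :=
  forall P p, code_at P p (compile p k) ->
  exists t c' n', [/\ (t <= T)%N,
    run P t (MState p c n) = MState (p + size (compile p k)) c' n' & Q c' n'].

Lemma runD P t1 t2 (x : mstate C) : run P (t1 + t2) x = run P t2 (run P t1 x).
Proof. by rewrite /run addnC iterD. Qed.

Lemma runS P t (x : mstate C) : run P t.+1 x = run P t (step P x).
Proof. by rewrite /run iterSr. Qed.

Lemma runs_le k c n T1 T2 (Q1 Q2 : (nat -> C) -> (nat -> nat) -> Prop) :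
  runs k c n T1 Q1 -> (T1 <= T2)%N -> (forall c' n', Q1 c' n' -> Q2 c' n') ->
  runs k c n T2 Q2.
Proof.
move=> h le12 Q12 P p /h[t [c' [n' [tT e q]]]]; exists t, c', n'.
by split=> //; [exact: leq_trans le12 | exact: Q12].
Qed.

Lemma runs_block l c n (Q : (nat -> C) -> (nat -> nat) -> Prop) :
  all straight l -> Q (execs l (c, n)).1 (execs l (c, n)).2 ->
  runs (Block l) c n (size l) Q.
Proof.
move=> sl q P p cp.
exists (size l), (execs l (c, n)).1, (execs l (c, n)).2; split=> //=.
elim: l c n p sl cp {q} => [|i l IH] c n p /=; first by rewrite addn0.
move=> /andP[si sl] /code_at_cons[ei cp].
rewrite runS step_straight ei //.
by rewrite IH //= addSnnS.
Qed.

Lemma runs_seq k1 k2 c n T1 T2 (Q : (nat -> C) -> (nat -> nat) -> Prop) :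
  runs k1 c n T1 (fun c' n' => runs k2 c' n' T2 Q) ->
  runs (Seq k1 k2) c n (T1 + T2) Q.
Proof.
move=> h P p /code_at_cat[/h[t1 [c1 [n1 [t1T e1 h2]]]]].
move=> /h2[t2 [c2 [n2 [t2T e2 q]]]].
exists (t1 + t2)%N, c2, n2; split=> //; first exact: leq_add.
by rewrite runD e1 e2 /= size_cat addnA.
Qed.

Lemma runs_unlessC a b k c n T (Q : (nat -> C) -> (nat -> nat) -> Prop) :
  (c a = c b -> Q c n) -> (c a != c b -> runs k c n T Q) ->
  runs (UnlessEqC a b k) c n T.+1 Q.
Proof.
move=> q h P p /code_at_cons[e0 cp].
have s0 : step P (MState p c n) =
    MState (if c a == c b then p.+1 + size (compile p.+1 k) else p.+1) c n.
  by rewrite /step e0.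
case: (eqVneq (c a) (c b)) s0 => [ab|/h hk] s0.
  by exists 1%N, c, n; rewrite runS s0 /= addSnnS; split=> //; exact: q.
have [t [c' [n' [tT e qq]]]] := hk _ _ cp.
by exists t.+1, c', n'; rewrite runS s0 e /= addSnnS.
Qed.

Lemma runs_unlessN a b k c n T (Q : (nat -> C) -> (nat -> nat) -> Prop) :
  (n a = n b -> Q c n) -> (n a != n b -> runs k c n T Q) ->
  runs (UnlessEqN a b k) c n T.+1 Q.
Proof.
move=> q h P p /code_at_cons[e0 cp].
have s0 : step P (MState p c n) =
    MState (if n a == n b then p.+1 + size (compile p.+1 k) else p.+1) c n.
  by rewrite /step e0.
case: (eqVneq (n a) (n b)) s0 => [ab|/h hk] s0.
  by exists 1%N, c, n; rewrite runS s0 /= addSnnS; split=> //; exact: q.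
have [t [c' [n' [tT e qq]]]] := hk _ _ cp.
by exists t.+1, c', n'; rewrite runS s0 e /= addSnnS.
Qed.

(** Besides its body an iteration pays for the test and the jump back; the exit costs the failed
    test and the jump out. [I j] is the invariant after [j] iterations. *)
Lemma runs_while a b k c n m T (I : nat -> (nat -> C) -> (nat -> nat) -> Prop) :
  (forall j c n, (j < m)%N -> I j c n -> (n a < n b)%N /\ runs k c n T (I j.+1)) ->
  (forall c n, I m c n -> (n b <= n a)%N) ->
  I 0%N c n ->
  runs (WhileLt a b k) c n (m * T.+2).+2 (I m).
Proof.
move=> body stop i0 P p /= /code_at_cons[e0] /code_at_cons[e1].
rewrite -cats1 => /code_at_cat[cp /code_at_cons[e2 _]].
pose e := (p.+2 + size (compile p.+2 k)).+1.
have s0 c1 n1 : step P (MState p c1 n1) =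
    MState (if (n1 a < n1 b)%N then p.+2 else p.+1) c1 n1 by rewrite /step e0.
have loop d j c1 n1 : (j + d = m)%N -> I j c1 n1 ->
    exists t c' n', [/\ (t <= (d * T.+2).+2)%N,
      run P t (MState p c1 n1) = MState e c' n' & I m c' n'].
  elim: d j c1 n1 => [|d IH] j c1 n1 jd ij.
    have {}jd : j = m by rewrite -jd addn0.
    move: ij; rewrite jd => im; have le := stop _ _ im.
    exists 2%N, c1, n1; split=> //.
    by rewrite !runS s0 ltnNge le /= /step e1.
  have [lt hk] : (n1 a < n1 b)%N /\ runs k c1 n1 T (I j.+1).
    by apply: body => //; rewrite -jd -addSnnS leq_addr.
  have [t [c2 [n2 [tT e3 i2]]]] := hk _ _ cp.
  have [|t' [c3 [n3 [tT' e4 i3]]]] := IH j.+1 c2 n2 _ i2.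
    by rewrite addSnnS.
  exists (t.+1 + t'.+1)%N, c3, n3; split=> //; first by rewrite mulSn; lia.
  by rewrite runD [run P t.+1 _]runS s0 lt e3 runS {1}/step e2 e4.
have [t [c' [n' [tT e3 im]]]] := loop m 0%N c n (add0n m) i0.
exists t, c', n'; split=> //; rewrite e3 /e /= size_cat /=.
by congr MState; lia.
Qed.

End Runs.

(** * The program *)

(* Index registers: 0 answer, 1 [r], 2 rank of [q], 3 [s = #|Sigma|], 4 one,
   5 [s^(r-1)], 6 the vertex [q...q], 7 round, 8 [s^r], 9 [n], 10 edge,
   11 its source, 12 its target, 13 its first letter, 14 table pointer,
   15 base [H] of the potential, 16 scratch, 17 letter count, 18 base [M] of
   the copy of the table, 19 zero.  The table is moved away from address 0
   because scratch registers can only be addressed by constants. *)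
Definition weight_loop : cmd :=
  WhileLt 17 3 (Block
    [:: CLoad 2 14; CConj 3 2; CMul 2 2 3; CAdd 1 1 2; NAdd 14 14 4; NAdd 17 17 4]).

(* The last two blocks advance the registers 10 to 13 without branching: for [a <= b] the truncated
   [1 - (b - a)] is 1 if [a = b] and 0 otherwise. *)
Definition edge_step : cmd :=
  Seq (Block [:: CConst 1 0; NConst 17 0])
  (Seq weight_loop
  (Seq (Block [:: NAdd 16 15 11; CLoad 2 16; CMul 1 2 1; NAdd 16 15 12; CLoad 2 16])
  (Seq (UnlessEqC 1 2 (Seq (Block [:: NConst 0 0])
                           (UnlessEqC 1 5 (Block [:: CStore 16 1]))))
  (Seq (Block [:: NAdd 10 10 4; NAdd 11 11 4;
                  NSub 16 5 11; NSub 16 4 16; NMul 16 16 5; NSub 11 11 16])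
       (Block [:: NAdd 13 13 4; NSub 16 3 13; NSub 16 4 16; NAdd 12 12 16;
                  NMul 16 16 3; NSub 13 13 16]))))).

Definition round_step : cmd :=
  Seq (Block [:: NConst 0 1; NConst 10 0; NConst 11 0; NConst 12 0; NConst 13 0;
                 NAdd 14 18 19])
  (Seq (WhileLt 10 8 edge_step) (Block [:: NAdd 7 7 4])).

(** The code of [q...q] is built by Horner's scheme. The counter starts at 1, which gives [r.-1]
    passes. *)
Definition power_loop : cmd :=
  Seq (Block [:: NConst 5 1; NConst 6 0; NConst 7 1])
      (WhileLt 7 1 (Block [:: NMul 5 5 3; NMul 6 6 3; NAdd 6 6 2; NAdd 7 7 4])).

(** Entry 0 is copied ahead of the loop, because the loop uses complex register 0 as scratch. *)
Definition copy_loop : cmd :=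
  Seq (Block [:: NMul 8 5 3; NMul 9 8 3; NConst 15 8; NAdd 18 9 15; NAdd 15 18 9;
                 CStore 18 0; NConst 10 1])
      (WhileLt 10 9 (Block [:: CLoad 0 10; NAdd 16 18 10; CStore 16 0; NAdd 10 10 4])).

Definition main_loop : cmd :=
  Seq (Block [:: NAdd 16 15 6; CConst 0 1; CStore 16 0; CConst 5 0; NConst 7 0])
      (WhileLt 7 1 round_step).

Definition lqca_program : cmd :=
  Seq (Block [:: NAdd 3 0 19; NConst 4 1])
      (UnlessEqN 0 4 (Seq power_loop (Seq copy_loop main_loop))).

(** * Correctness and running time of the program *)

Section Algorithm.
Variables (C : numClosedFieldType) (tab : nat -> C) (s r : nat).
Hypotheses (s_gt0 : 0 < s) (r_gt0 : 0 < r).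

Let pw := s ^ r.-1.

Definition edge_weight (W : nat) : C :=
  (\sum_(x < s) tab (W * s + x)%N * (tab (W * s + x)%N)^*)%R.

(* An edge [W < s ^ r] lists the letters of a word in base [s], first letter
   least significant: its source is [W %% s ^ r.-1] and its target [W %/ s].
   The value 0 marks a vertex that has not been reached; the flag is lowered
   as soon as some edge fails the potential equation. *)
Definition relax (W : nat) (p : (nat -> C) * bool) : (nat -> C) * bool :=
  let t := (p.1 (W %% pw)%N * edge_weight W)%R in
  if t == p.1 (W %/ s) then p
  else (if t == 0%R then p.1 else upd p.1 (W %/ s) t, false).

Definition round (p : (nat -> C) * bool) : (nat -> C) * bool :=
  iteri (s ^ r) relax (p.1, true).

Let n := s ^ r.+1.
(** The offset 8 keeps the copy clear of the loaded table and, even for small [n], of the scratch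
    registers. *)
Let M := n + 8.
Let H := M + n.

Record layout (x : nat -> nat) : Prop := Layout {
  lay1 : x 1 = r; lay3 : x 3 = s; lay4 : x 4 = 1; lay5 : x 5 = pw;
  lay8 : x 8 = s ^ r; lay15 : x 15 = H; lay18 : x 18 = M; lay19 : x 19 = 0 }.

(* [c 5 = 0] is the constant against which reached vertices are tested. *)
Record memory (h : nat -> C) (c : nat -> C) : Prop := Memory {
  mem_tab : forall i, i < n -> c (M + i) = tab i;
  mem_pot : forall x, x < pw -> c (H + x) = h x;
  mem5 : c 5 = 0%R }.

Let pw_gt0 : 0 < pw. Proof. by rewrite expn_gt0 s_gt0. Qed.
Let pwS : pw * s = s ^ r. Proof. by rewrite mulnC -expnS prednK. Qed.
Let Sn : s ^ r * s = n. Proof. by rewrite /n expnSr. Qed.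

Lemma runs_weight_loop c x W :
  layout x -> W < s ^ r -> (forall i, i < n -> c (M + i) = tab i) ->
  c 1 = 0%R -> x 17 = 0 -> x 14 = M + W * s ->
  runs weight_loop c x (s * 8).+2 (fun c' x' =>
    [/\ c' 1 = edge_weight W, (forall j, 3 < j -> c' j = c j),
        x' 14 = M + W.+1 * s & forall j, j \notin [:: 14; 17] -> x' j = x j]).
Proof.
move=> lx WS tabc c1 x17 x14.
pose I j (c' : nat -> C) x' :=
  [/\ x' 17 = j, x' 14 = M + (W * s + j),
     c' 1 = (\sum_(y < j) tab (W * s + y)%N * (tab (W * s + y)%N)^*)%R,
     (forall i, 3 < i -> c' i = c i) &
     forall i, i \notin [:: 14; 17] -> x' i = x i].
apply: runs_le (runs_while (I := I) (m := s) (T := 6) _ _ _) _ _ => //.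
- move=> j c' x' js [e17 e14 e1 fc fx]; split.
    by rewrite e17 fx // (lay3 lx).
  apply: (@runs_block _ [:: _; _; _; _; _; _]) => //=; split=> /=.
  + by rewrite /upd /= e17 fx // (lay4 lx) addn1.
  + by rewrite /upd /= e14 fx // (lay4 lx) -addnA addn1 -addnS.
  + rewrite /upd /= big_ord_recr /= e1 e14; congr (_ + _)%R.
    rewrite fc; last by rewrite /M; lia.
    rewrite tabc // -Sn; nia.
  + by move=> i i3; rewrite /upd !ifN ?fc //; lia.
  + move=> i ni; rewrite /upd (fx i ni); move: ni.
    by rewrite !inE negb_or => /andP[/negPf-> /negPf->].
- by move=> c' x' [e17 _ _ _ fx]; rewrite e17 fx // (lay3 lx).
- by split; rewrite ?x14 ?addn0 ?big_ord0.
- move=> c' x' [_ e14 e1 fc fx]; split=> //.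
  by rewrite e14 mulSn addnA [s + _]addnC addnA.
Qed.

Record edge_state (k W : nat) (p : (nat -> C) * bool) c (x : nat -> nat) : Prop :=
  EdgeState {
  es_layout : layout x; es_memory : memory p.1 c;
  es0 : x 0 = p.2; es7 : x 7 = k; es10 : x 10 = W; es11 : x 11 = W %% pw;
  es12 : x 12 = W %/ s; es13 : x 13 = W %% s; es14 : x 14 = M + W * s }.

Lemma modn_succ_sub d m : 0 < d ->
  (m %% d).+1 - (1 - (d - (m %% d).+1)) * d = m.+1 %% d.
Proof.
move=> d0; rewrite modnS; have := ltn_pmod m d0.
case: ifP => [dv|nd] lt.
  have : (m %% d).+1 = d; last by lia.
  apply/eqP; rewrite eqn_leq lt /=.
  apply: dvdn_leq => //; move: dv.
  by rewrite {1}(divn_eq m d) -addnS dvdn_addr // dvdn_mull.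
have ne : (m %% d).+1 <> d.
  move=> e; move: nd.
  by rewrite {1}(divn_eq m d) -addnS e dvdn_addr ?dvdnn // dvdn_mull.
by have -> : 1 - (d - (m %% d).+1) = 0 by lia.
Qed.

Lemma divn_succ_sub d m : 0 < d ->
  m %/ d + (1 - (d - (m %% d).+1)) = m.+1 %/ d.
Proof.
move=> d0; have := modn_succ_sub m d0.
have := divn_eq m d; have := divn_eq m.+1 d; have := ltn_pmod m d0.
have := ltn_pmod m.+1 d0.
move: (m %/ d) (m %% d) (m.+1 %/ d) (m.+1 %% d) => a b a' b'; nia.
Qed.

Lemma runs_edge_step c x k W p :
  W < s ^ r -> edge_state k W p c x ->
  runs edge_step c x (s * 8 + 26) (edge_state k W.+1 (relax W p)).
Proof.
move=> WS [lx mc x0 x7 x10 x11 x12 x13 x14].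
apply: runs_le (_ : runs _ _ _ (2 + ((s * 8).+2 + (5 + ((1 + 2).+1 + (6 + 6))))) _) _ _; last 2 first.
- lia.
- by move=> c' x'; apply.
have u_lt : W %% pw < pw by rewrite ltn_pmod.
have v_lt : W %/ s < pw by rewrite ltn_divLR // pwS.
apply: runs_seq; apply: (@runs_block _ [:: _; _]) => //=.
apply: runs_seq; apply: runs_le (leqnn _) _.
  apply: (runs_weight_loop (W := W)) => //=.
  - by case: lx; split.
  - move=> i iN; rewrite /upd ifN; last by rewrite /M; lia.
    exact: (mem_tab mc).
move=> c1 x1 [/= e1 fc e14 fx].
have {}fx j : j \notin [:: 14; 17] -> x1 j = x j.
  move=> jn; rewrite fx //; move: jn.
  by rewrite /upd !inE negb_or => /andP[_ /negPf->].
have {}fc j : 3 < j -> c1 j = c j.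
  by move=> j3; rewrite fc // /upd ifN //; lia.
have l1 : layout x1 by case: lx; split; rewrite fx.
have m1 : memory p.1 c1.
  case: mc => ma mb m5; split.
  - by move=> i iN; rewrite fc ?ma // /M; lia.
  - by move=> i iN; rewrite fc ?mb // /H /M; lia.
  - by rewrite fc.
have H4 i : (H + i == 1) = false /\ (H + i == 2) = false /\ (H + i == 5) = false.
  by rewrite /H /M; split; [|split]; lia.
apply: runs_seq; apply: (@runs_block _ [:: _; _; _; _; _]) => //=.
match goal with |- runs _ ?a ?b _ _ => set c2 := a; set x2 := b end.
have x2E j : j != 16 -> x2 j = x1 j by rewrite /x2 /upd; case: eqP.
have x216 : x2 16 = H + W %/ s by rewrite /x2 /upd /= (lay15 l1) fx // x12.
have c2E j : 3 < j -> c2 j = c1 j by move=> j3; rewrite /c2 /upd !ifN //; lia.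
have c21 : c2 1 = (p.1 (W %% pw)%N * edge_weight W)%R.
  by rewrite /c2 /upd /= (lay15 l1) fx // x11 (mem_pot m1) // e1.
have c22 : c2 2 = p.1 (W %/ s).
  by rewrite /c2 /upd /= (lay15 l1) !fx // x12 !(H4 _).1 (H4 _).2.1 (mem_pot m1).
have m2 : memory p.1 c2.
  case: m1 => ma mb m5; split.
  - by move=> i iN; rewrite c2E ?ma // /M; lia.
  - by move=> i iN; rewrite c2E ?mb // /H /M; lia.
  - by rewrite c2E.
have c25 := mem5 m2.
have l2 : layout x2 by case: l1; split; rewrite x2E.
have {e14}e14 : x2 14 = M + W.+1 * s by rewrite x2E.
have {}fx j : j \notin [:: 14; 16; 17] -> x2 j = x j.
  rewrite !inE !negb_or => /and3P[j14 j16 j17].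
  by rewrite x2E // fx // !inE negb_or j14.
apply: runs_seq; apply: runs_le (leqnn _) _.
  apply: (runs_unlessC (Q := fun c' x' =>
    [/\ memory (relax W p).1 c', x' 0 = (relax W p).2 &
        forall j, j != 0 -> x' j = x2 j])).
    rewrite c21 c22 => e; split=> //.
      by rewrite /relax e eqxx.
    by rewrite /relax e eqxx fx.
  rewrite c21 c22 => ne; apply: runs_seq; apply: (@runs_block _ [:: _]) => //=.
  apply: runs_unlessC => /=; rewrite c21 c25 => e.
    split=> [|//|j j0]; rewrite /relax ?(negPf ne) /= ?e ?eqxx //.
    by rewrite /upd (negPf j0).
  apply: (@runs_block _ [:: _]) => //=; rewrite /relax (negPf ne) /= (negPf e).
  split=> [|//|j j0]; last by rewrite /upd (negPf j0).
  case: m2 => ma mb m5; split=> /=; rewrite /upd /= x216 c21.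
  - by move=> i iN; rewrite ifN ?ma // /H; lia.
  - by move=> i ip; rewrite eqn_add2l mb.
  - by rewrite ifN // /H /M; lia.
move=> c3 x3 [m3 x30 f3].
have f30 := f3 14 isT.
have {}f3 j : j \notin [:: 0; 14; 16; 17] -> x3 j = x j.
  by rewrite inE negb_or => /andP[j0 jn]; rewrite f3 // fx.
have l3 : layout x3 by case: lx; split; rewrite f3.
have e3 : x3 14 = M + W.+1 * s by rewrite f30 e14.
case: (l3) => a1 a3 a4 a5 a8 a15 a18 a19.
apply: runs_seq; apply: (@runs_block _ [:: _; _; _; _; _; _]) => //=.
match goal with |- runs _ _ ?b _ _ => set x4 := b end.
have x4E j : j \notin [:: 10; 11; 16] -> x4 j = x3 j.
  rewrite !inE !negb_or => /and3P[/negPf j10 /negPf j11 /negPf j16].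
  by rewrite /x4 /upd j10 j11 j16.
have x410 : x4 10 = W.+1 by rewrite /x4 /upd /= f3 // x10 a4 addn1.
have x411 : x4 11 = W.+1 %% pw.
  by rewrite /x4 /upd /= a4 a5 f3 // x11 addn1 modn_succ_sub.
clearbody x4.
apply: (@runs_block _ [:: _; _; _; _; _; _]) => //=.
split=> //.
- by split; rewrite /upd /= x4E.
- by rewrite /upd /= x4E.
- by rewrite /upd /= x4E // f3.
- by rewrite /upd /= !x4E // a4 a3 !f3 // x12 x13 addn1 divn_succ_sub.
- by rewrite /upd /= !x4E // a4 a3 !f3 // x13 addn1 modn_succ_sub.
- by rewrite /upd /= x4E.
Qed.

(** The guard on [rs0] is there because index register 0 still holds [s] before the first round. *)
Record round_state (k : nat) (p : (nat -> C) * bool) c (x : nat -> nat) : Prop :=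
  RoundState {
  rs_layout : layout x; rs_memory : memory p.1 c; rs7 : x 7 = k;
  rs0 : 0 < k -> x 0 = p.2 }.

Lemma runs_round_step c x k p :
  round_state k p c x ->
  runs round_step c x (s ^ r * (s * 8 + 28) + 9) (round_state k.+1 (round p)).
Proof.
move=> [lx mc x7 _].
apply: runs_le (_ : runs _ _ _ (6 + ((s ^ r * (s * 8 + 26).+2).+2 + 1)) _) _ _; last 2 first.
- by rewrite -addn2 -[X in X.+2]addn2 -!addnA; lia.
- by move=> c' x'; apply.
apply: runs_seq; apply: (@runs_block _ [:: _; _; _; _; _; _]) => //=.
apply: runs_seq; apply: runs_le (leqnn _) _.
  apply: (runs_while (I := fun W => edge_state k W (iteri W relax (p.1, true)))).
  - move=> W c' x' WS es; split; last exact: runs_edge_step.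
    by rewrite (lay8 (es_layout es)) (es10 es).
  - by move=> c' x' [lx' _ _ _ -> *]; rewrite (lay8 lx').
  - case: lx => a1 a3 a4 a5 a8 a15 a18 a19.
    split=> //=; rewrite ?mod0n ?div0n // /upd /= a18 a19 //.
move=> c1 x1 [lx1 mc1 x10 x17 *].
apply: (@runs_block _ [:: _]) => //=; split=> //.
- by case: lx1 => *; split.
- by rewrite /upd /= x17 (lay4 lx1) addn1.
Qed.

Lemma runs_power_loop (c : nat -> C) x q :
  x 0 = s -> x 1 = r -> x 2 = q -> x 3 = s -> x 4 = 1 -> x 19 = 0 ->
  runs power_loop c x (r * 6 + 5) (fun c' x' =>
    [/\ c' = c, x' 5 = pw, x' 6 = \sum_(k < r.-1) q * s ^ k &
        forall j, j \notin [:: 5; 6; 7] -> x' j = x j]).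
Proof.
move=> x0 x1 x2 x3 x4 x19.
apply: runs_le (_ : runs _ _ _ (3 + (r.-1 * 6).+2) _) _ _; last 2 first.
- lia.
- by move=> c' x'; apply.
apply: runs_seq; apply: (@runs_block _ [:: _; _; _]) => //=.
pose I j (c' : nat -> C) x' :=
  [/\ c' = c, x' 7 = j.+1, x' 5 = s ^ j, x' 6 = \sum_(k < j) q * s ^ k &
     forall i, i \notin [:: 5; 6; 7] -> x' i = x i].
apply: runs_le (leqnn _) _; first apply: (runs_while (I := I)).
- move=> j c' x' jr [-> e7 e5 e6 fx]; split.
    by rewrite e7 fx // x1; lia.
  apply: (@runs_block _ [:: _; _; _; _]) => //=; split=> //.
  + by rewrite /upd /= e7 fx // x4 addn1.
  + by rewrite /upd /= e5 fx // x3 expnSr.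
  + rewrite /upd /= e6 !fx // x3 x2 big_ord_recl muln1 addnC big_distrl /=.
    by congr (_ + _); apply: eq_bigr => i _; rewrite expnSr mulnA.
  + move=> i ni; rewrite /upd (fx i ni); move: ni.
    by rewrite !inE !negb_or => /and3P[/negPf-> /negPf-> /negPf->].
- by move=> c' x' [_ -> _ _ fx]; rewrite fx // x1 prednK.
- split=> //=; first by rewrite /upd /= big_ord0.
  move=> i; rewrite !inE !negb_or /upd.
  by move=> /and3P[/negPf-> /negPf-> /negPf->].
- by move=> c' x' [].
Qed.

(** Nothing is written from [H] on, so the array of the potential starts with the value 0, the mark
    of an unreached vertex, without any initialisation. *)
Lemma runs_copy_loop (c : nat -> C) x :
  (forall j, j < n -> c j = tab j) -> (forall j, n <= j -> c j = 0%R) ->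
  x 1 = r -> x 3 = s -> x 4 = 1 -> x 5 = pw -> x 19 = 0 ->
  runs copy_loop c x (n * 6 + 9) (fun c' x' =>
    [/\ layout x', forall i, i < n -> c' (M + i) = tab i,
        forall i, H <= i -> c' i = 0%R & x' 6 = x 6]).
Proof.
move=> ctab c0 x1 x3 x4 x5 x19.
apply: runs_le (_ : runs _ _ _ (7 + (n.-1 * 6).+2) _) _ _; last 2 first.
- lia.
- by move=> c' x'; apply.
have n0 : 0 < n by rewrite expn_gt0 s_gt0.
apply: runs_seq; apply: (@runs_block _ [:: _; _; _; _; _; _; _]) => //=.
match goal with |- runs _ ?a ?b _ _ => set c1 := a; set x' := b end.
pose I j (c' : nat -> C) y :=
  [/\ layout y /\ y 9 = n, y 10 = j.+1 /\ y 6 = x 6,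
     forall i, i <= j -> c' (M + i) = tab i, forall i, H <= i -> c' i = 0%R &
     forall i, 0 < i < n -> c' i = tab i].
have e8 : pw * s = s ^ r by exact: pwS.
apply: runs_le (leqnn _) _; first apply: (runs_while (I := I)).
- move=> j c' y jn [[ly y9] [y10 y6] ca cz ct]; split.
    by rewrite y10 y9; lia.
  apply: (@runs_block _ [:: _; _; _; _]) => //=; split=> //.
  + by split; [case: ly; split|].
  + by split=> //; rewrite /upd /= y10 (lay4 ly) addn1.
  + move=> i ij; rewrite /upd /= (lay18 ly) y10 eqn_add2l.
    case: eqP => [->|ne]; first by apply: ct; lia.
    by rewrite ifN ?ca //; rewrite /M; lia.
  + move=> i Hi; rewrite /upd /= (lay18 ly) y10 !ifN ?cz //; move: Hi; rewrite /H /M; lia.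
  + move=> i ni; rewrite /upd /= (lay18 ly) y10 !ifN ?ct //; move: ni; rewrite /M; lia.
- by move=> c' y [[_ ->] [-> _] _ _ _]; rewrite prednK.
- have x'8 : x' 8 = s ^ r by rewrite /x' /upd /= x5 x3.
  have x'9 : x' 9 = n by rewrite /x' /upd /= x5 x3 pwS Sn.
  have x'18 : x' 18 = M by rewrite /x' /upd /= x5 x3 pwS Sn.
  have x'15 : x' 15 = H by rewrite /x' /upd /= x5 x3 pwS Sn.
  split=> //.
  + by move=> i; rewrite leqn0 => /eqP->; rewrite /c1 /upd /= x5 x3 pwS Sn addn0 eqxx ctab.
  + move=> i Hi; rewrite /c1 /upd /= x5 x3 pwS Sn ifN ?c0 //.
      by move: Hi; rewrite /H /M; lia.
    by move: Hi; rewrite /H /M; lia.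
  + move=> i /andP[i0 iN]; rewrite /c1 /upd /= x5 x3 pwS Sn ifN ?ctab //; lia.
- move=> c' y [[ly _] [_ y6] ca cz _]; split=> // i iN.
  by apply: ca; lia.
Qed.

Definition initial_potential (Q : nat) : (nat -> C) * bool :=
  (upd (fun=> 0%R) Q 1%R, true).

Lemma runs_main_loop c x Q :
  layout x -> (forall i, i < n -> c (M + i) = tab i) ->
  (forall i, H <= i -> c i = 0%R) -> x 6 = Q ->
  runs main_loop c x (r * (s ^ r * (s * 8 + 28) + 11) + 7) (fun c' x' =>
    x' 0 = (iter r round (initial_potential Q)).2).
Proof.
move=> lx ctab cz x6.
apply: runs_le (_ : runs _ _ _ (5 + (r * (s ^ r * (s * 8 + 28) + 9).+2).+2) _) _ _; last 2 first.
- by move: (s ^ r * _) => m; nia.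
- by move=> c' x'; apply.
apply: runs_seq; apply: (@runs_block _ [:: _; _; _; _; _]) => //=.
apply: runs_le (leqnn _) _; first apply: (runs_while (I := fun k =>
    round_state k (iter k round (initial_potential Q)))).
- move=> k c' y kr rs; split; last exact: runs_round_step.
  by rewrite (rs7 rs) (lay1 (rs_layout rs)).
- by move=> c' y [ly _ -> _]; rewrite (lay1 ly).
- split=> //.
  + by case: lx => *; split.
  + split=> [i iN|i ip|//]; rewrite /upd /= (lay15 lx) x6.
      by rewrite !ifN ?ctab //; rewrite /H /M; lia.
    have [-> ->] : (H + i == 5) = false /\ (H + i == 0) = false by rewrite /H /M; split; lia.
    by rewrite eqn_add2l cz ?leq_addr.
- by move=> c' y rs; rewrite (rs0 rs).
Qed.

Lemma runs_lqca_program (c : nat -> C) x q :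
  (forall j, j < n -> c j = tab j) -> (forall j, n <= j -> c j = 0%R) ->
  x 0 = s -> x 1 = r -> x 2 = q -> (forall j, 3 <= j -> x j = 0) ->
  runs lqca_program c x (100 * n ^ 2 + 100) (fun c' x' =>
    (x' 0 != 0) = (s == 1) ||
      (iter r round (initial_potential (\sum_(k < r.-1) q * s ^ k))).2).
Proof.
move=> ctab cz x0 x1 x2 x3.
apply: runs_le (_ : runs _ _ _ (2 + (100 * n ^ 2 + 97).+1) _) _ _; last 2 first.
- lia.
- by move=> c' x'; apply.
apply: runs_seq; apply: (@runs_block _ [:: _; _]) => //=.
match goal with |- runs _ _ ?b _ _ => set y := b end.
have yE j : j \notin [:: 3; 4] -> y j = x j.
  by rewrite !inE negb_or /y /upd => /andP[/negPf-> /negPf->].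
have y3 : y 3 = s by rewrite /y /upd /= x0 x3 // addn0.
(* If [s = 1] the body is skipped and register 0 still holds [s], which is nonzero and means
   acceptance. *)
apply: runs_unlessN; rewrite yE // x0 /y /upd /= -/y.
  by move=> ->.
move=> s1; have s2 : 2 <= s by lia.
rewrite (negPf s1) /=.
have rn : r <= n.
  by rewrite /n (leq_trans (ltnW (ltnW (ltn_expl r.+1 (ltnSn 1))))) // leq_exp2r.
(* A round costs at most [36 * n + 11] steps, and there are [r <= n] rounds. *)
have cost : r * 6 + 5 + (n * 6 + 9 + (r * (s ^ r * (s * 8 + 28) + 11) + 7))
    <= 100 * n ^ 2 + 97.
  have Sle : s ^ r <= n by rewrite /n leq_exp2l.
  have -> : s ^ r * (s * 8 + 28) = 8 * n + 28 * s ^ r.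
    by rewrite -Sn; nia.
  have : r * (8 * n + 28 * s ^ r + 11) <= n * (36 * n + 11).
    by apply: leq_mul => //; lia.
  nia.
have y4 : y 4 = 1 by [].
have y0 : y 0 = s by rewrite yE.
have y1 : y 1 = r by rewrite yE.
have y2 : y 2 = q by rewrite yE.
have y19 : y 19 = 0 by rewrite yE // x3.
apply: runs_le cost _; last by move=> c' x'; apply.
apply: runs_seq; apply: runs_le (leqnn _) _.
  by apply: (runs_power_loop _ y0 y1 y2 y3 y4 y19).
move=> c1 x' [-> e5 e6 fx].
apply: runs_seq; apply: runs_le (leqnn _) _.
  by apply: runs_copy_loop => //; rewrite fx.
move=> c2 z [lz ctab2 cz2 z6].
apply: runs_le (runs_main_loop lz ctab2 cz2 (etrans z6 e6)) (leqnn _) _.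
by move=> c' x'' ->; case: (_.2).
Qed.

Lemma lqca_program_run (c : nat -> C) x q :
  (forall j, j < n -> c j = tab j) -> (forall j, n <= j -> c j = 0%R) ->
  x 0 = s -> x 1 = r -> x 2 = q -> (forall j, 3 <= j -> x j = 0) ->
  let fin := run (compile 0 lqca_program) (100 * n ^ 2 + 100) (MState 0 c x) in
  halted (compile 0 lqca_program) fin /\
  accepts fin = (s == 1) ||
      (iter r round (initial_potential (\sum_(k < r.-1) q * s ^ k))).2.
Proof.
move=> ctab cz x0 x1 x2 x3; set P := compile 0 lqca_program => fin.
have [|t [c' [x' [tT e acc]]]] := @runs_lqca_program c x q ctab cz x0 x1 x2 x3 P 0.
  by move=> k _.
(* The code ends past its last instruction, where the default [Halt] keeps the state fixed for the
   rest of the budget. *)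
have {}e : fin = MState (size P) c' x'.
  rewrite /fin -(subnKC tT) runD e /run.
  by elim: (_ - t) => //= d ->.
by rewrite e.
Qed.

End Algorithm.

(** * Relaxation and potentials *)

Section Digits.
Variable s : nat.

(** A word is given as the first [m] letters of an infinite sequence, so that moving along a walk is
    a shift of the index. *)
Definition enc (m : nat) (f : nat -> nat) : nat := \sum_(k < m) f k * s ^ k.

Definition dig (W k : nat) : nat := W %/ s ^ k %% s.

Lemma enc_recr m f : enc m.+1 f = enc m f + f m * s ^ m.
Proof. by rewrite /enc big_ord_recr. Qed.

Lemma enc_recl m f : enc m.+1 f = f 0 + enc m (fun k => f k.+1) * s.
Proof.
rewrite /enc big_ord_recl muln1 big_distrl /=.
by congr (_ + _); apply: eq_bigr => k _; rewrite expnSr mulnA.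
Qed.

Lemma eq_enc m f g : (forall k, k < m -> f k = g k) -> enc m f = enc m g.
Proof. by move=> fg; apply: eq_bigr => k _; rewrite fg. Qed.

Lemma enc_lt m f : (forall k, k < m -> f k < s) -> enc m f < s ^ m.
Proof.
elim: m => [|m IH] fs; first by rewrite /enc big_ord0.
have /IH : forall k, k < m -> f k < s by move=> k km; apply: fs; exact: ltnW.
have := fs m (ltnSn m); rewrite enc_recr expnS.
move: (s ^ m) (enc m f) (f m) => x y z; nia.
Qed.

Lemma enc_mod m f : (forall k, k < m -> f k < s) -> enc m.+1 f %% s ^ m = enc m f.
Proof. by move=> fs; rewrite enc_recr addnC modnMDl modn_small // enc_lt. Qed.

Lemma enc_div m f : f 0 < s -> enc m.+1 f %/ s = enc m (fun k => f k.+1).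
Proof.
move=> f0; rewrite enc_recl addnC divnMDl ?divn_small ?addn0 //.
exact: leq_ltn_trans f0.
Qed.

Lemma enc_mod_pred m f : 0 < m -> (forall k, f k < s) ->
  enc m f %% s ^ m.-1 = enc m.-1 f.
Proof. by case: m => // m _ fs; exact: enc_mod. Qed.

Lemma enc_div_pred m f : 0 < m -> f 0 < s ->
  enc m f %/ s = enc m.-1 (fun k => f k.+1).
Proof. by case: m => // m _; exact: enc_div. Qed.

Lemma dig_lt W k : 0 < s -> dig W k < s.
Proof. exact: ltn_pmod. Qed.

Lemma enc_dig m W : W < s ^ m -> enc m (dig W) = W.
Proof.
elim: m W => [|m IH] W; first by rewrite ltnS leqn0 /enc big_ord0 => /eqP.
have [->|s0] := posnP s; first by rewrite exp0n.
move=> WS; rewrite enc_recl {1}/dig divn1.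
have -> : enc m (fun k => dig W k.+1) = enc m (dig (W %/ s)).
  by apply: eq_enc => k _; rewrite /dig expnS divnMA.
by rewrite IH ?ltn_divLR -?expnSr // addnC -divn_eq.
Qed.

Lemma enc_inj m f g : (forall k, k < m -> f k < s) -> (forall k, k < m -> g k < s) ->
  enc m f = enc m g -> forall k, k < m -> f k = g k.
Proof.
elim: m => [//|m IH] fs gs e k; rewrite ltnS leq_eqVlt => km.
have fs' j : j < m -> f j < s by move=> jm; apply: fs; exact: ltnW.
have gs' j : j < m -> g j < s by move=> jm; apply: gs; exact: ltnW.
have e' : enc m f = enc m g by rewrite -(enc_mod fs') e enc_mod.
case/orP: km => [/eqP->|km]; last exact: IH.
move: e; rewrite !enc_recr e' => /addnI /eqP; rewrite eqn_pmul2r; first by move/eqP.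
by rewrite expn_gt0 (leq_ltn_trans (leq0n _) (fs m (ltnSn m))).
Qed.

End Digits.

(** * Relaxation decides whether a potential exists *)

Section Relaxation.
Variables (C : numClosedFieldType) (tab : nat -> C) (s r : nat).
Hypotheses (s_gt0 : 0 < s) (r_gt0 : 0 < r).
Hypothesis weight_neq0 : forall W, W < s ^ r -> edge_weight tab s W != 0%R.

Let pw := s ^ r.-1.
Let wt := edge_weight tab s.
Let rel := relax tab s r.

Definition is_potential (g : nat -> C) : Prop :=
  forall W, W < s ^ r -> (g (W %% s ^ r.-1)%N * edge_weight tab s W)%R = g (W %/ s).

Let rS : r = r.-1.+1. Proof. by rewrite prednK. Qed.

(** Only nonzero values are ever stored, so a reached vertex stays reached. *)
Lemma relax_neq0 W p v : p.1 v != 0%R -> (rel W p).1 v != 0%R.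
Proof.
rewrite /rel /relax; case: ifP => //= _; case: ifP => //= /negbT t0 p0.
by rewrite /upd; case: ifP.
Qed.

Lemma iteri_relax_neq0 k p v : p.1 v != 0%R -> (iteri k rel p).1 v != 0%R.
Proof. by move=> p0; elim: k => //= k; exact: relax_neq0. Qed.

Lemma round_target_neq0 p W : W < s ^ r -> p.1 (W %% pw)%N != 0%R ->
  (round tab s r p).1 (W %/ s) != 0%R.
Proof.
move=> WS p0; rewrite /round -/rel.
have : (iteri W.+1 rel (p.1, true)).1 (W %/ s) != 0%R.
  have := iteri_relax_neq0 (p := (p.1, true)) W p0.
  rewrite /=; move: (iteri _ _ _) => {p0}p pu.
  have t0 : (p.1 (W %% pw)%N * edge_weight tab s W != 0)%R.
    by rewrite mulf_neq0 ?weight_neq0.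
  rewrite /rel /relax -/pw; case: ifP => [/eqP<-//|_].
  by rewrite (negPf t0) /= /upd eqxx.
elim: (s ^ r) WS => // k IH; rewrite ltnS leq_eqVlt => /orP[/eqP->//|Wk] h.
by apply: relax_neq0; exact: IH.
Qed.

(** Every round treats all edges, in particular the next edge of the walk [z], so each round reaches
    at least one further vertex along it. *)
Lemma iter_round_neq0 k p z : (forall i, z i < s) ->
  p.1 (enc s r.-1 z) != 0%R ->
  (iter k (round tab s r) p).1 (enc s r.-1 (fun j => z (k + j))) != 0%R.
Proof.
move=> zs p0; elim: k => [//|k IH].
have [e1 e2] : enc s r (fun j => z (k + j)) %% pw = enc s r.-1 (fun j => z (k + j)) /\
    enc s r (fun j => z (k + j)) %/ s = enc s r.-1 (fun j => z (k.+1 + j)).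
  rewrite enc_mod_pred // enc_div_pred //; split=> //.
  by apply: eq_enc => j _; rewrite addnS.
by rewrite iterS -e2 round_target_neq0 ?enc_lt // e1.
Qed.

(** A lowered flag is never raised within a round. If it is still up, no edge changed anything, so
    each edge was tested against the initial values. *)
Lemma iteri_relax_true k p : (iteri k rel p).2 ->
  (iteri k rel p).1 = p.1 /\
  forall W, W < k -> (p.1 (W %% pw)%N * wt W)%R = p.1 (W %/ s).
Proof.
elim: k => [//|k IH] /=; move: (iteri _ _ _) IH => x IH.
rewrite /rel /relax -/pw.
case: ifP => // /eqP e /IH[e1 h]; split=> // W.
rewrite ltnS leq_eqVlt => /orP[/eqP->|]; last exact: h.
by rewrite -e1.
Qed.

(** An unreached source stores nothing; from a source with value [g] the equation for [g] gives the
    target the value [g]. *)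
Lemma relax_below_potential g W p : is_potential g -> W < s ^ r ->
  (forall v, p.1 v = 0%R \/ p.1 v = g v) ->
  forall v, (rel W p).1 v = 0%R \/ (rel W p).1 v = g v.
Proof.
move=> pg WS pv v; rewrite /rel /relax -/pw; case: ifP => //= _; case: ifP => //= t0.
rewrite /upd; case: eqP => // ->; right; rewrite -pg //.
by case: (pv (W %% pw)) t0 => ->//; rewrite mul0r eqxx.
Qed.

Lemma iter_round_below_potential g k p : is_potential g ->
  (forall v, p.1 v = 0%R \/ p.1 v = g v) ->
  forall v, (iter k (round tab s r) p).1 v = 0%R \/ (iter k (round tab s r) p).1 v = g v.
Proof.
move=> pg pv; elim: k => [//|k IH]; rewrite iterS /round -/rel.
move: (iter _ _ _) IH => {pv}p pv.
have : s ^ r <= s ^ r by [].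
elim: {1 3 4}(s ^ r) => [//|j IH] js /=.
by apply: relax_below_potential => //; apply: IH; exact: ltnW.
Qed.

Lemma relaxation_correct q : q < s ->
  let Q := enc s r.-1 (fun=> q) in
  (iter r (round tab s r) (initial_potential C Q)).2 <->
  exists g, g Q = 1%R /\ is_potential g.
Proof.
move=> qs Q; rewrite rS iterS -rS.
set p := iter _ _ _; split.
  move=> /iteri_relax_true[_ /= pp].
  have pQ : p.1 Q != 0%R.
    apply: (@iter_round_neq0 r.-1 _ (fun=> q)) => //=.
    by rewrite /upd eqxx oner_neq0.
  (* The rounds may have overwritten the value at [Q], so it is divided out. *)
  exists (fun v => p.1 v / p.1 Q)%R; split; first by rewrite divff.
  by move=> W WS; rewrite mulrAC pp.
move=> [g [gQ pg]].
have pE v : v < pw -> p.1 v = g v.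
  move=> vp; case: (@iter_round_below_potential g r.-1 (initial_potential C Q) pg _ v) => //.
    by move=> u /=; rewrite /upd; case: eqP => [->|_]; [right|left].
  move/eqP/negPn/negP; case.
  (* This walk starts at [q...q] and stands at [v] after [r.-1] steps. *)
  pose z i := if i < r.-1 then q else dig s v (i - r.-1).
  have zs i : z i < s by rewrite /z; case: ifP => // _; exact: dig_lt.
  have <- : enc s r.-1 (fun j => z (r.-1 + j)) = v.
    rewrite -[RHS](enc_dig vp); apply: eq_enc => j _.
    by rewrite /z ltnNge leq_addr /= addKn.
  apply: iter_round_neq0 => //=; rewrite (@eq_enc _ _ _ (fun=> q)) ?/upd ?eqxx ?oner_neq0 //.
  by move=> j jr; rewrite /z jr.
have : s ^ r <= s ^ r by [].
rewrite /round -/rel.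
suff h k : k <= s ^ r -> iteri k rel (p.1, true) = (p.1, true) by move=> _; rewrite h.
elim: k => [//|k IH] ks /=; rewrite IH ?(ltnW ks) // /rel /relax /= -/pw.
by rewrite !pE ?ltn_pmod ?expn_gt0 ?s_gt0 ?ltn_divLR -?expnSr -?rS // pg ?eqxx.
Qed.

End Relaxation.

(** * Closed walks of weight 1 and potentials *)

Section ClosedWalks.
Variables (C : numClosedFieldType) (tab : nat -> C) (s r q : nat).
Hypotheses (r_gt0 : 0 < r) (q_lt : q < s).

Let wt (y : nat -> nat) : C := edge_weight tab s (enc s r y).
Let s_gt0 : 0 < s. Proof. exact: leq_ltn_trans q_lt. Qed.

Lemma potential_telescope g (y : nat -> nat) L : is_potential tab s r g ->
  (forall i, y i < s) ->
  (g (enc s r.-1 y) * \prod_(k < L) edge_weight tab s (enc s r (fun j => y (k + j)%N)))%R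
  = g (enc s r.-1 (fun j => y (L + j))).
Proof.
move=> pg ys; elim: L => [|L IH]; first by rewrite big_ord0 mulr1.
rewrite big_ord_recr mulrA IH /=.
have := pg (enc s r (fun j => y (L + j))) (enc_lt (fun k _ => ys _)).
rewrite enc_mod_pred // enc_div_pred // => ->.
by congr g; apply: eq_enc => j _; rewrite addnS.
Qed.

(* The potential of [y] is the weight [P y] of the walk reading [q...q y].
   With [S z] the weight of the walk back from [z], the closed walks through
   the edge [y] and through its target [z] give [P y * wt y * S z = 1 = P z * S z]. *)
Lemma potential_of_closed_walks :
  (forall (y : nat -> nat) m, (forall i, y i < s) ->
     (forall i, i < r.-1 -> y i = q) -> (forall i, m <= i -> y i = q) ->
     (\prod_(k < m) edge_weight tab s (enc s r (fun j => y (k + j)%N)) = 1)%R) ->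
  exists g, g (enc s r.-1 (fun=> q)) = 1%R /\ is_potential tab s r g.
Proof.
move=> closed.
have eq_wt y z : (forall j, j < r -> y j = z j) -> wt y = wt z.
  by move=> yz; rewrite /wt (eq_enc _ yz).
(* [pre y] puts [r.-1] letters [q] before [y], and [suf y] follows [r.-1] letters of [y] by [q]
   forever. Their first [r.-1] edges are the walks from [q...q] to the vertex [y] and back. *)
pose pre (y : nat -> nat) i := if i < r.-1 then q else y (i - r.-1).
pose suf (y : nat -> nat) i := if i < r.-1 then y i else q.
pose P y := (\prod_(p < r.-1) wt (fun j => pre y (p + j)%N))%R.
pose S y := (\prod_(p < r.-1) wt (fun j => suf y (p + j)%N))%R.
have eq_P y z : (forall j, j < r.-1 -> y j = z j) -> P y = P z.
  move=> yz; apply: eq_bigr => p _; apply: eq_wt => j jr.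
  by rewrite /pre; case: ifP => // h; apply: yz; have := ltn_ord p; lia.
have PS y : (forall i, y i < s) -> (P y * S y = 1)%R.
  move=> ys; rewrite -(closed (pre (suf y)) (r.-1 + r.-1)).
  - rewrite big_split_ord; congr (_ * _)%R; apply: eq_bigr => p _; apply: eq_wt => j jr;
      have := ltn_ord p; rewrite /pre /suf /=.
      by case: ifP => // h pr; case: ifP => //; lia.
    have -> : (r.-1 + p + j < r.-1) = false by lia.
    by have -> : r.-1 + p + j - r.-1 = p + j by lia.
  - by move=> i; rewrite /pre /suf; do 2 case: ifP => //.
  - by move=> i; rewrite /pre => ->.
  - move=> i ri; rewrite /pre /suf; case: ifP => // _; case: ifP => //; lia.
have PwS y : (forall i, y i < s) -> (P y * wt y * S (fun j => y j.+1) = 1)%R.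
  (* The closed walk through the edge [y]: [r.-1] edges in, the edge itself, [r.-1] edges out. *)
  move=> ys; pose x i := if i < r.-1 + r then pre y i else q.
  rewrite -(closed x (r.-1 + 1 + r.-1)).
  - rewrite !big_split_ord big_ord1; congr (_ * _ * _)%R.
    + apply: eq_bigr => p _; apply: eq_wt => j jr; have := ltn_ord p.
      by rewrite /x /=; case: ifP => //; lia.
    + apply: eq_wt => j jr.
      by rewrite /x /= addn0 ltn_add2l jr /pre ltnNge leq_addr addKn.
    + apply: eq_bigr => p _; apply: eq_wt => j jr; have := ltn_ord p.
      rewrite /x /pre /suf /= => pr.
      have -> : (r.-1 + 1 + p + j < r.-1) = false by lia.
      have -> : r.-1 + 1 + p + j - r.-1 = (p + j).+1 by lia.
      by have -> : (r.-1 + 1 + p + j < r.-1 + r) = (p + j < r.-1) by lia.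
  - by move=> i; rewrite /x /pre; do 2 case: ifP => //.
  - by move=> i ir; rewrite /x /pre ir; case: ifP.
  - by move=> i ri; rewrite /x ifN //; lia.
have wtq : wt (fun=> q) = 1%R by rewrite -(closed (fun=> q) 1) // big_ord1.
(* [P] reads only [r.-1] letters, so it is a function of the vertex. *)
have digP y : (forall i, y i < s) -> P (dig s (enc s r.-1 y)) = P y.
  move=> ys; apply: eq_P; apply: (@enc_inj s).
  - by move=> k _; exact: dig_lt.
  - by [].
  - by rewrite enc_dig // enc_lt.
exists (fun v => P (dig s v)); split.
  rewrite digP // /P big1 // => p _; rewrite -[RHS]wtq; apply: eq_wt => j _.
  by rewrite /pre; case: ifP.
move=> W WS; pose y := dig s W.
have ys i : y i < s by exact: dig_lt.
have <- : enc s r y = W by rewrite enc_dig.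
rewrite enc_mod_pred // enc_div_pred // !digP //.
have S0 : S (fun j => y j.+1) != 0%R.
  by apply: contra_eq_neq (PwS _ ys) => ->; rewrite mulr0 eq_sym oner_neq0.
by apply: (mulIf S0); rewrite PwS // PS.
Qed.

End ClosedWalks.

Local Open Scope ring_scope.

(** * Norms of the columns *)

Section Columns.
Local Open Scope classical_set_scope.
Variables (R : realType) (Sigma : finType) (r : nat) (q : Sigma).
Variables (N : r.-tuple int) (delta : r.-tuple Sigma -> Sigma -> R[i]).
Hypothesis delta_q : forall x, delta [tuple of nseq r q] x = (x == q)%:R.

Let normc : R[i] -> R := @ComplexField.Normc.normc R.

Lemma normc0_sq : normc 0 ^+ 2 = 0 :> R.
Proof. by rewrite /normc ComplexField.Normc.normc0 expr0n. Qed.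

Lemma normc_prod (I : finType) (F : I -> R[i]) :
  normc (\prod_i F i) = \prod_i normc (F i).
Proof.
apply: (big_morph normc).
  exact: ComplexField.Normc.normcM.
exact: ComplexField.Normc.normc1.
Qed.

Definition row_sqnorm (w : r.-tuple Sigma) : R := \sum_(x : Sigma) normc (delta w x) ^+ 2.

Section Window.
Variables (c : int -> Sigma) (lo : int) (L : nat).
Hypothesis quiescent_outside : forall i : int,
  ~~ (lo <= i < lo + L%:Z) -> nbhd_at N c i = [tuple of nseq r q].

Let fill (f : {ffun 'I_L -> Sigma}) (i : int) : Sigma :=
  match i - lo with Posz k => oapp f q (insub k) | Negz _ => q end.

Let fill_in f (k : 'I_L) : fill f (lo + k%:Z) = f k.
Proof. by rewrite /fill addrAC subrr add0r valK. Qed.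

Let fill_out f i : ~~ (lo <= i < lo + L%:Z) -> fill f i = q.
Proof.
move=> iout; rewrite /fill; case E: (i - lo) => [k|//].
by rewrite insubN //; lia.
Qed.

Let fill_config f : config q (fill f).
Proof.
apply: (@sub_finite_set _ _ [set` [seq lo + (k : nat)%:Z | k <- index_iota 0 L]]); last first.
  exact: finite_seq.
move=> i /= fi; have : lo <= i < lo + L%:Z.
  by apply/negPn/negP => /fill_out e; rewrite e eqxx in fi.
move=> iin; apply/mapP; exists `|i - lo|%N; first by rewrite mem_index_iota; lia.
by lia.
Qed.

Let fill_inj : injective fill.
Proof. by move=> f g fg; apply/ffunP => k; rewrite -!fill_in fg. Qed.

Lemma U_A_quiescent d : (forall i, ~~ (lo <= i < lo + L%:Z) -> d i = q) ->
  U_A N delta d c = \prod_(k < L) delta (nbhd_at N c (lo + k%:Z)) (d (lo + k%:Z)).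
Proof.
move=> dq; rewrite /U_A.
pose S := [seq lo + (k : nat)%:Z | k <- index_iota 0 L].
rewrite -(fsbig_widen [set` S]) //; last first.
  move=> i [_ /= iS]; rewrite /preimage /=.
  have iout : ~~ (lo <= i < lo + L%:Z).
    apply/negP => iin; apply: iS; apply/mapP; exists `|i - lo|%N.
      by rewrite mem_index_iota; lia.
    by lia.
  by rewrite quiescent_outside // delta_q dq // eqxx.
rewrite -fsbig_seq; last first.
  by rewrite map_inj_uniq ?iota_uniq // => k l; lia.
by rewrite big_map big_mkord.
Qed.

Lemma U_A_not_quiescent d i : config q d -> ~~ (lo <= i < lo + L%:Z) -> d i != q ->
  U_A N delta d c = 0.
Proof.
move=> dc iout di; rewrite /U_A.
have F0 : delta (nbhd_at N c i) (d i) = 0.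
  by rewrite quiescent_outside // delta_q (negPf di).
(* All factors outside this finite set are 1. Finiteness has to be shown, since a product with
   infinitely many factors other than 1 defaults to 1 and would hide the zero factor. *)
pose S := [set j | d j != q] `|` [set` [seq lo + (k : nat)%:Z | k <- index_iota 0 L]].
have fin : finite_set S by rewrite finite_setU; split=> //; exact: finite_seq.
rewrite -(fsbig_widen S) => [|//|j [_ /not_orP[/= dj jS]]].
  by rewrite (fsbigD1 i) //= ?F0 ?mul0r //; left.
rewrite /preimage /=.
have jout : ~~ (lo <= j < lo + L%:Z).
  apply/negP => iin; apply: jS; apply/mapP; exists `|j - lo|%N.
    by rewrite mem_index_iota; lia.
  by lia.
by rewrite quiescent_outside // delta_q; move/negP/negPn: dj => ->.
Qed.

(** Outside the window the rule forces [q], so only the rows [fill f] contribute. There are finitely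
    many of them, and the sum over [f] of products distributes into a product of sums. *)
Lemma column_sqnorm_prod :
  column_sqnorm q N delta c = (\prod_(k < L) row_sqnorm (nbhd_at N c (lo + k%:Z)))%:E.
Proof.
rewrite /column_sqnorm esum_mkcond.
transitivity (\esum_(d in fill @` [set: {ffun 'I_L -> Sigma}])
    (normc (U_A N delta d c) ^+ 2)%:E).
  rewrite [RHS]esum_mkcond; apply: eq_esum => d _.
  case: ifPn => [|dN]; last first.
    by rewrite ifN //; apply: contra dN; rewrite !inE => -[f _ <-].
  rewrite inE => dc; case: ifPn => // dN.
  have [dq|] := pselect (forall i, ~~ (lo <= i < lo + L%:Z) -> d i = q).
    case/negP: dN; rewrite inE; exists [ffun k : 'I_L => d (lo + k%:Z)] => //.
    apply/funext => i; have [iin|iout] := boolP (lo <= i < lo + L%:Z); last first.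
      by rewrite fill_out // dq.
    have kL : (`|i - lo| < L)%N by lia.
    have -> : i = lo + (Ordinal kL)%:Z by rewrite /=; lia.
    by rewrite fill_in ffunE.
  move=> /existsNP[i /not_implyP[iout /eqP di]].
  by rewrite (U_A_not_quiescent dc iout di) normc0_sq.
rewrite esum_image; last by move=> f g _ _; exact: fill_inj.
rewrite esum_fset; last 2 first.
- exact: finite_finset.
- by move=> f _; rewrite lee_fin sqr_ge0.
rewrite (fsbigE (enum {ffun 'I_L -> Sigma})) ?enum_uniq //; last first.
  by move=> f; rewrite mem_enum.
rewrite sumEFin; congr (_%:E).
rewrite /row_sqnorm bigA_distr_bigA /=.
rewrite big_enum_cond /=; apply: eq_big => [f|f _]; first by rewrite in_setT.
rewrite U_A_quiescent; last by move=> i; exact: fill_out.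
rewrite normc_prod -prodrXl; apply: eq_bigr => k _.
by rewrite fill_in.
Qed.

End Window.
End Columns.

(** * Columns as closed walks weighted by the table *)

Section TableWeights.
Local Open Scope classical_set_scope.
Variables (R : realType) (Sigma : finType) (r : nat) (q : Sigma).
Variables (N : r.-tuple int) (delta : r.-tuple Sigma -> Sigma -> R[i]).
Hypotheses (lqca : is_LQCA q N delta) (simple : simple_nbhd N).
Variable tab : nat -> R[i].
Hypothesis tabE : forall w x, tab (table_index w x) = delta w x.

Local Notation s := #|Sigma|.
Local Notation a0 := (nth 0 N 0).

Let r_gt0 : (0 < r)%N. Proof. by case: lqca. Qed.
Let delta_q x : delta [tuple of nseq r q] x = (x == q)%:R. Proof. by case: lqca. Qed.

(** Each of the [r.-1] gaps is at least 1 and together they make [r.-1], so each is exactly 1. *)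
Lemma simple_nbhd_nth k : (k < r)%N -> nth 0 N k = a0 + k%:Z.
Proof.
have [_ srt _ _] := lqca.
have grow d j : (j + d < r)%N -> nth 0 N j + d%:Z <= nth 0 N (j + d).
  elim: d => [|d IH] jd; first by rewrite addn0 addr0.
  have h : nth 0 N (j + d) < nth 0 N (j + d).+1.
    by move/(sortedP 0): srt; apply; rewrite size_tuple -addnS.
  have := IH (ltnW (etrans (congr1 (fun x => (x < r)%N) (esym (addnS j d))) jd)).
  rewrite addnS; lia.
move=> kr; have := grow k 0%N kr; have := grow (r.-1 - k)%N k.
rewrite subnKC ?add0n; last by lia.
have -> : (r.-1 < r)%N by lia.
move=> /(_ isT); move: simple; rewrite /simple_nbhd; lia.
Qed.

Lemma tnth_nbhd_at (c : int -> Sigma) i k : tnth (nbhd_at N c i) k = c (i + a0 + (k : nat)%:Z).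
Proof.
by rewrite tnth_map (tnth_nth 0) (simple_nbhd_nth (ltn_ord k)) addrA.
Qed.

Lemma nbhd_at_quiescent (c : int -> Sigma) i :
  (forall k, (k < r)%N -> c (i + a0 + k%:Z) = q) -> nbhd_at N c i = [tuple of nseq r q].
Proof.
move=> cq; apply: eq_from_tnth => k.
by rewrite tnth_nbhd_at cq // (tnth_nth q) /= nth_nseq ltn_ord.
Qed.

Lemma edge_weight_row w :
  edge_weight tab s (\sum_(k < r) enum_rank (tnth w k) * s ^ k)%N =
  real_complex R (row_sqnorm delta w).
Proof.
rewrite /edge_weight (reindex (@enum_rank Sigma)) /=; last first.
  exact/onW_bij/enum_rank_bij.
rewrite /row_sqnorm rmorph_sum; apply: eq_bigr => x _.
by rewrite -[X in tab X]/(table_index w x) tabE -normCK rmorphXn.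
Qed.

Lemma edge_weight_nbhd (c : int -> Sigma) i (y : nat -> nat) :
  (forall k, (k < r)%N -> y k = enum_rank (c (i + a0 + k%:Z))) ->
  edge_weight tab s (enc s r y) = real_complex R (row_sqnorm delta (nbhd_at N c i)).
Proof.
move=> yE; rewrite -edge_weight_row; congr edge_weight.
by apply: eq_bigr => k _; rewrite yE // tnth_nbhd_at.
Qed.

Definition letter (n : nat) : Sigma := nth q (enum Sigma) n.

Lemma letter_enum_rank x : letter (enum_rank x) = x.
Proof. exact: nth_enum_rank. Qed.

Lemma enum_rank_letter n : (n < s)%N -> enum_rank (letter n) = n :> nat.
Proof.
by move=> ns; rewrite -[n]/(val (Ordinal ns)) -(enum_valK (Ordinal ns)) letter_enum_rank.
Qed.

Lemma edge_weight_neq0 W : (W < s ^ r)%N -> edge_weight tab s W != 0.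
Proof.
move=> WS; have s_gt0 : (0 < s)%N by apply/card_gt0P; exists q.
have -> : W = (\sum_(k < r) enum_rank (tnth [tuple letter (dig s W k) | k < r] k) * s ^ k)%N.
  rewrite -{1}(enc_dig WS); apply: eq_bigr => k _.
  by rewrite tnth_mktuple enum_rank_letter // dig_lt.
rewrite edge_weight_row fmorph_eq0 gt_eqF //.
by have [_ _ delta_gt0 _] := lqca; exact: delta_gt0.
Qed.

Lemma columns_potential :
  (forall c, config q c -> column_sqnorm q N delta c = 1%E) <->
  exists g, g (enc s r.-1 (fun=> enum_rank q)) = 1 /\ is_potential tab s r g.
Proof.
split=> [col1|[g [gQ pg]] c cq].
  apply: potential_of_closed_walks => //.
  move=> y m ys ylo yhi.
  (* The shift by [a0] makes the neighbourhood of cell [k] the edge read from position [k] of [y],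
     so the window is the cells from 0 to [m], [m] excluded. *)
  pose c (i : int) := match i - a0 with Posz p => letter (y p) | Negz _ => q end.
  have letter_q n : y n = enum_rank q -> letter (y n) = q.
    by move=> ->; exact: letter_enum_rank.
  have cE p : c (a0 + p%:Z) = letter (y p) by rewrite /c addrAC subrr add0r.
  have c_hi (i : int) : a0 + m%:Z <= i -> c i = q.
    move=> mi; have -> : i = a0 + `|i - a0|%N%:Z by lia.
    by rewrite cE letter_q // yhi //; lia.
  have c_lo (i : int) : i < a0 + r.-1%:Z -> c i = q.
    move=> ir; rewrite /c; case E: (i - a0) => [p|//].
    by rewrite letter_q // ylo //; lia.
  have c_supp (i : int) : c i != q -> i \in [seq a0 + (k : nat)%:Z | k <- index_iota 0 m].
    move=> /eqP ci.
    have lo_i : a0 + r.-1%:Z <= i by rewrite leNgt; apply/negP => /c_lo.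
    have i_hi : i < a0 + m%:Z by rewrite ltNge; apply/negP => /c_hi.
    apply/mapP; exists `|i - a0|%N; last by lia.
    by rewrite mem_index_iota; lia.
  have c_config : config q c by exact: sub_finite_set c_supp (finite_seq _).
  have := col1 c c_config.
  rewrite (column_sqnorm_prod (lo := 0) (L := m) delta_q); last first.
    move=> i; rewrite add0r negb_and -!ltNge => /orP iout.
    apply: nbhd_at_quiescent => k kr.
    case: iout => iout; [apply: c_lo|apply: c_hi]; lia.
  move=> [prod1]; rewrite -[RHS](rmorph1 (real_complex R)) -prod1 rmorph_prod.
  apply: eq_bigr => k _; apply: edge_weight_nbhd => j jr.
  by rewrite add0r addrAC addrC -PoszD cE enum_rank_letter // addnC.
have /finite_seqP[l lE] : finite_set [set i | c i != q] := cq.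
pose B := (\max_(i <- l) `|i|.+1)%N.
have c_out (i : int) : (B <= `|i|)%N -> c i = q.
  move=> Bi; apply/eqP/negPn/negP => ci.
  have il : i \in l by have : [set` l] i by rewrite -lE.
  by have := leq_trans (leq_bigmax_seq (F := fun j : int => `|j|.+1) i il isT) Bi; rewrite ltnn.
(* With the shift by [a0] undone, the walk reads [c] from cell [-(B + r)]. Its first vertex lies
   left of the support, and after [L] steps it starts at cell [B], right of the support. *)
pose lo : int := - (B + r)%:Z - a0.
pose L := (B + B + r)%N.
rewrite (column_sqnorm_prod (lo := lo) (L := L) delta_q); last first.
  move=> i iout; apply: nbhd_at_quiescent => k kr; apply: c_out.
  by move: iout; rewrite /lo /L; lia.
pose y (j : nat) : nat := enum_rank (c (- (B + r)%:Z + j%:Z)).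
have ys j : (y j < s)%N by exact: ltn_ord.
have := potential_telescope r_gt0 L pg ys.
have e1 : enc s r.-1 y = enc s r.-1 (fun=> enum_rank q).
  by apply: eq_enc => j jr; rewrite /y c_out //; lia.
have e2 : enc s r.-1 (fun j => y (L + j)%N) = enc s r.-1 (fun=> enum_rank q).
  by apply: eq_enc => j jr; rewrite /y c_out // /L; lia.
rewrite e1 e2 gQ mul1r => prod1; congr (_%:E).
apply: (fmorph_inj (real_complex R)); rewrite rmorph1 -prod1 rmorph_prod.
apply: eq_bigr => k _; apply/esym/edge_weight_nbhd => j jr.
by rewrite /y; congr (nat_of_ord (enum_rank (c _))); rewrite /lo; lia.
Qed.

Lemma row_sqnorm_quiescent : row_sqnorm delta [tuple of nseq r q] = 1.
Proof.
rewrite /row_sqnorm (bigD1 q) //= big1 ?addr0 => [|x /negPf xq].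
  by rewrite delta_q eqxx ComplexField.Normc.normc1 expr1n.
by rewrite delta_q xq ComplexField.Normc.normc0 expr0n.
Qed.

(** The only edge is the loop [q...q], of weight 1 by quiescence. *)
Lemma potential_one_state : s = 1%N -> is_potential tab s r (fun=> 1).
Proof.
move=> s1 W; rewrite /= mul1r {1}s1 exp1n ltnS leqn0 => /eqP->.
have := edge_weight_row [tuple of nseq r q]; rewrite row_sqnorm_quiescent rmorph1 => <-.
congr edge_weight; rewrite big1 // => k _.
have := ltn_ord (enum_rank (tnth [tuple of nseq r q] k)).
by rewrite {2}s1 ltnS leqn0 => /eqP->.
Qed.

End TableWeights.


(* One fixed program P and one constant K such that, for every simple LQCA
   whose table delta is loaded in the complex registers (delta(w)(x) at
   address table_index w x, all other registers 0) and with |Sigma|, r and the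
   index of q in index registers 0,1,2, the machine halts within
   K * n^2 + K steps, n = |Sigma|^(r+1), and accepts iff every column
   U_A(.,c), c in C_A, has norm 1. *)
Theorem theorem4 :
  exists (P : seq instr) (K : nat),
  forall (R : realType) (Sigma : finType) (r : nat) (q : Sigma)
         (N : r.-tuple int) (delta : r.-tuple Sigma -> Sigma -> R[i]),
    is_LQCA q N delta -> simple_nbhd N ->
    forall (cm : nat -> R[i]) (im : nat -> nat),
      (forall (w : r.-tuple Sigma) (x : Sigma), cm (table_index w x) = delta w x) ->
      (forall j, (#|Sigma| ^ r.+1 <= j)%N -> cm j = 0) ->
      im 0%N = #|Sigma| -> im 1%N = r -> im 2%N = enum_rank q ->
      (forall j, (3 <= j)%N -> im j = 0%N) ->
      let n := (#|Sigma| ^ r.+1)%N in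
      let fin := run P (K * n ^ 2 + K) (MState 0 cm im) in
      halted P fin /\
      (accepts fin <->
        (forall c : int -> Sigma, config q c ->
           column_sqnorm q N delta c = 1%E)).
Proof.
exists (compile 0 lqca_program), 100%N.
move=> R Sigma r q N delta lqca simple cm im cmE cm0 im0 im1 im2 im3 n fin.
have r_gt0 : (0 < r)%N by case: lqca.
have s_gt0 : (0 < #|Sigma|)%N by apply/card_gt0P; exists q.
(* The loaded memory [cm] itself serves as [tab]. *)
have [halt acc] := lqca_program_run s_gt0 r_gt0 (fun _ _ => erefl) cm0 im0 im1 im2 im3.
split; first exact: halt.
have -> : accepts fin = _ := acc.
rewrite (columns_potential lqca simple cmE).
have [s1|s_neq1] /= := eqVneq #|Sigma| 1%N.
  split=> // _; exists (fun=> 1); split=> //.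
  exact: (potential_one_state lqca cmE s1).
apply: relaxation_correct => //.
exact: (edge_weight_neq0 lqca cmE).
Qed.
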